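(* Let $s\ge g\ge 3$ with $s>(g-1)^2$, and let $V$ be the set of treatments of a pseudo-$L_g(s)$ association scheme. Suppose that for every treatment $t\in V$ there are chosen pairwise disjoint sets $A^t_1,\dots,A^t_g$, each of cardinality $s-1$, whose union is the set of first associates of $t$, such that each $\{t\}\cup A^t_i$ is a clique, and such that for every $i$, every $a\in A^t_i$ and every $j\neq i$, exactly $g-2$ treatments of $A^t_j$ are first associates of $a$. Then: (1) for every $t$, every $i$ and every $a\in A^t_i$, the only clique of cardinality $s$ containing $t$ and $a$ is $\{t\}\cup A^t_i$; (2) for any two distinct first associates $t_1,t_2$, writing $A^1_i=A^{t_1}_i$, $A^2_j=A^{t_2}_j$, and letting $i_1,j_1$ be the indices with $t_2\in A^1_{i_1}$ and $t_1\in A^2_{j_1}$: (a) $\{t_1\}\cup A^1_{i_1}=\{t_2\}\cup A^2_{j_1}$, and this is the unique clique of cardinality $s$ containing $t_1$ and $t_2$; (b) for every $i_2\neq i_1$ there is exactly one $j_2\neq j_1$ with $(\{t_1\}\cup A^1_{i_2})\cap(\{t_2\}\cup A^2_{j_2})=\emptyset$, and for every $j'\notin\{j_1,j_2\}$ the intersection $(\{t_1\}\cup A^1_{i_2})\cap(\{t_2\}\cup A^2_{j'})$ consists of a single treatment, which is a first associate of both $t_1$ and $t_2$; (c) for every $j_3\neq j_1$ there is exactly one $i_3\neq i_1$ with $(\{t_2\}\cup A^2_{j_3})\cap(\{t_1\}\cup A^1_{i_3})=\emptyset$, and for every $i'\notin\{i_1,i_3\}$ the intersection $(\{t_2\}\cup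 A^2_{j_3})\cap(\{t_1\}\cup A^1_{i'})$ consists of a single treatment, which is a first associate of both $t_1$ and $t_2$.
   Context: An association scheme with two associate classes on $v$ treatments is a symmetric relation splitting every pair of distinct treatments into first or second associates such that each treatment has $n_i$ $i$-th associates and for two $i$-th associates the number of treatments that are $j$-th associates of the first and $k$-th associates of the second is a constant $p^i_{jk}$. A pseudo-$L_g(s)$ association scheme has $v=s^2$, $n_1=g(s-1)$, $p^1_{11}=(s-2)+(g-1)(g-2)$, $p^2_{11}=g(g-1)$. A clique is a set of treatments any two distinct of which are first associates. *)

(* Defs.v *)
From mathcomp Require Import all_boot.

Set Implicit Arguments.
Unset Strict Implicit.
Unset Printing Implicit Defensive.

Variant assoc_class := First | Second.

(* The scheme is carried by the relation [fa] of being first associates;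
   distinct treatments that are not first associates are second associates. *)
Definition associates (T : finType) (fa : rel T) (c : assoc_class) : rel T :=
  fun x y => match c with
             | First => fa x y
             | Second => (x != y) && ~~ fa x y
             end.

Record assoc_scheme2 (T : finType) (fa : rel T)
    (n : assoc_class -> nat)
    (p : assoc_class -> assoc_class -> assoc_class -> nat) : Prop := {
  assoc_sym : symmetric fa;
  assoc_irr : irreflexive fa;
  assoc_valency : forall (i : assoc_class) (x : T),
    #|[set y | associates fa i x y]| = n i;
  (* [p i j k] is the parameter usually written p^i_{jk}. *)
  assoc_intersection : forall (i j k : assoc_class) (x y : T),
    associates fa i x y ->
    #|[set z | associates fa j x z && associates fa k y z]| = p i j k
}.

(* Subtraction on nat is truncated: the formulas have their usual meaning for
   2 <= s and 2 <= g. *)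
Record pseudo_Lg (T : finType) (fa : rel T) (g s : nat)
    (n : assoc_class -> nat)
    (p : assoc_class -> assoc_class -> assoc_class -> nat) : Prop := {
  pseudo_scheme : assoc_scheme2 fa n p;
  pseudo_card : #|T| = s ^ 2;
  pseudo_n1 : n First = g * (s - 1);
  pseudo_p111 : p First First First = (s - 2) + (g - 1) * (g - 2);
  pseudo_p211 : p Second First First = g * (g - 1)
}.

Definition clique (T : finType) (fa : rel T) (K : {set T}) : Prop :=
  {in K &, forall x y : T, x != y -> fa x y}.

Definition clique_through (T : finType) (fa : rel T) (s : nat) (x y : T)
    (K : {set T}) : Prop :=
  [/\ clique fa K, #|K| = s, x \in K & y \in K].

(* Main.v *)
(* Write L(t, i) for the s-clique t |: A t i. A clique containing t and meeting
   two of the sets A t k meets each of them in at most g - 2 treatments, hence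
   has at most 1 + g (g - 2) = (g - 1)^2 < s treatments. So each edge lies in
   exactly one s-clique, and distinct L(t, i) share at most one treatment. For
   i2 != i1, the g - 2 first associates of t2 in A t1 i2 are therefore spread
   over the g - 1 cliques L(t2, j), j != j1, with at most one in each: exactly
   one of these cliques receives none. *)
Require Import Defs.
From mathcomp Require Import all_boot.

Set Implicit Arguments.
Unset Strict Implicit.
Unset Printing Implicit Defensive.

Section LocalCliqueDecomposition.

Variables (T : finType) (fa : rel T) (g s : nat).
Hypotheses (g_ge2 : 2 <= g) (s_gt : (g - 1) ^ 2 < s).
Hypothesis fa_irr : irreflexive fa.
Variable A : T -> 'I_g -> {set T}.
Hypothesis A_disj :
  forall (t : T) (i j : 'I_g), i != j -> [disjoint A t i & A t j].
Hypothesis A_card : forall (t : T) (i : 'I_g), #|A t i| = s - 1.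
Hypothesis A_cover : forall t : T, \bigcup_(i < g) A t i = [set x | fa t x].
Hypothesis A_clique : forall (t : T) (i : 'I_g), clique fa (t |: A t i).
Hypothesis A_nbr : forall (t : T) (i : 'I_g) (a : T), a \in A t i ->
  forall j : 'I_g, j != i -> #|[set b in A t j | fa a b]| = g - 2.

Lemma fa_in_A t x : fa t x -> exists i, x \in A t i.
Proof.
have -> : fa t x = (x \in \bigcup_(i < g) A t i) by rewrite A_cover inE.
by case/bigcupP=> i _; exists i.
Qed.

Lemma in_A_fa t i x : x \in A t i -> fa t x.
Proof.
move=> xA; have: x \in \bigcup_(i < g) A t i by apply/bigcupP; exists i.
by rewrite A_cover inE.
Qed.

Lemma in_A_inj t i j x : x \in A t i -> x \in A t j -> i = j.
Proof.
move=> xi xj; apply/eqP/contraT => /(A_disj t)/disjointFr/(_ xi).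
by rewrite xj.
Qed.

Lemma center_notin_A t i : t \notin A t i.
Proof. by apply/negP => /in_A_fa; rewrite fa_irr. Qed.

Lemma card_clique_A t i : #|t |: A t i| = s.
Proof.
by rewrite cardsU1 center_notin_A A_card addnC subnK //; case: (s) s_gt.
Qed.

(** The sets [A t i] partition the first associates of [t]. This serves both counts: with [B] a
    clique through [t], and with [B] one of the sets [A t1 i2] seen from an adjacent center [t2]. *)
Lemma card_fa_decomp t (B : {set T}) :
  #|[set b in B | fa t b]| = \sum_(i < g) #|B :&: A t i|.
Proof.
have -> : [set b in B | fa t b] = \bigcup_(i < g) (B :&: A t i).
  by rewrite -big_distrr /= A_cover; apply/setP => b; rewrite !inE.
rewrite -sum1_card partition_disjoint_bigcup => [|i j neq_ij].
  by apply: eq_bigr => i _; rewrite sum1_card.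
by apply: disjointW (A_disj t neq_ij); apply: subsetIr.
Qed.

Lemma clique_sub_A t i a (K : {set T}) :
  clique_through fa s t a K -> a \in A t i -> K \subset t |: A t i.
Proof.
case=> K_cl K_card tK aK aA; apply/subsetP => b bK; rewrite !inE.
apply/norP => -[neq_bt /negP bNA].
have [j bA] : exists j, b \in A t j by apply/fa_in_A/K_cl; rewrite // eq_sym.
(* A member [c] of [K] in [A t l] is adjacent to all of [K] in [A t k], so the cross-adjacency count
   bounds that part. *)
have small c l k : c \in K -> c \in A t l -> k != l -> #|K :&: A t k| <= g - 2.
  move=> cK cA neq_kl; rewrite -(A_nbr cA neq_kl).
  apply/subset_leq_card/subsetP => x; rewrite !inE => /andP[xK xA].
  rewrite xA /=; apply: K_cl => //; apply: contra neq_kl => /eqP eq_cx.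
  by apply/eqP/(in_A_inj (t := t) (x := x)) => //; rewrite -eq_cx.
(* The witness [a] handles every [k != i]; the stray point [b], lying in another [A t j], handles
   [k = i]. *)
have small_all k : #|K :&: A t k| <= g - 2.
  have [eq_ki | neq_ki] := eqVneq k i; last exact: small aA neq_ki.
  apply: (small b j) => //; rewrite eq_ki; apply/eqP => eq_ij.
  by apply: bNA; rewrite eq_ij.
have K_eq : #|K| = (\sum_(k < g) #|K :&: A t k|).+1.
  rewrite -card_fa_decomp (cardsD1 t K) tK add1n; congr _.+1; apply: eq_card => x.
  rewrite !inE andbC; case xK: (x \in K) => //=; apply/idP/idP => [neq_xt|].
    by apply: K_cl; rewrite // eq_sym.
  by apply: contraTneq => ->; rewrite fa_irr.
have: \sum_(k < g) #|K :&: A t k| <= \sum_(k < g) (g - 2) by apply: leq_sum.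
rewrite sum_nat_const card_ord.
rewrite leqNgt -ltnS -K_eq K_card => /negP; apply; apply: leq_ltn_trans s_gt.
(* With [g = h + 2] this is [(h + 2) * h + 1 = (h + 1) ^ 2]. *)
by case: g g_ge2 => [|[|h]] // _; rewrite !subSS !subn0 -mulnn mulSn mulnS.
Qed.

Lemma unique_clique_through t i a :
  a \in A t i -> unique (clique_through fa s t a) (t |: A t i).
Proof.
move=> aA; split=> [|K K_thr].
  by split; [apply: A_clique | apply: card_clique_A | rewrite setU11 | rewrite setU1r].
apply/eqP; rewrite eq_sym eqEcard (clique_sub_A K_thr aA) card_clique_A.
by case: K_thr => _ -> _ _; rewrite leqnn.
Qed.

(** Both sides are [s]-cliques through the edge [x], [y], so both equal the clique [x |: A x k] with
    [y] in [A x k]. *)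
Lemma s_clique_eq t u i j x y :
  x != y -> x \in t |: A t i -> y \in t |: A t i ->
  x \in u |: A u j -> y \in u |: A u j -> t |: A t i = u |: A u j.
Proof.
move=> neq_xy xt yt xu yu.
have [k yA] := fa_in_A (A_clique xt yt neq_xy).
have [_ uniq_K] := unique_clique_through yA.
by rewrite -[LHS]uniq_K -1?[RHS]uniq_K //; split;
  rewrite ?card_clique_A //; apply: A_clique.
Qed.

Section Edge.

Variables (t1 t2 : T) (i1 j1 : 'I_g).
Hypotheses (t2A : t2 \in A t1 i1) (t1A : t1 \in A t2 j1).

Lemma edge_clique_eq : t1 |: A t1 i1 = t2 |: A t2 j1.
Proof.
apply: (s_clique_eq (x := t1) (y := t2)); rewrite ?setU11 ?setU1r //.
by apply: contraTneq t2A => ->; apply: center_notin_A.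
Qed.

(** Neither center is a common point: among the sets around the other center, each lies only in the
    one indexed [i1] or [j1]. *)
Lemma setI_cliques i j : i != i1 -> j != j1 ->
  (t1 |: A t1 i) :&: (t2 |: A t2 j) = A t1 i :&: A t2 j.
Proof.
move=> neq_i neq_j; apply/setP => x; rewrite !inE.
have t1N : t1 \notin A t2 j.
  by apply: contra neq_j => t1j; apply/eqP/(in_A_inj (t := t2) (x := t1)).
have t2N : t2 \notin A t1 i.
  by apply: contra neq_i => t2i; apply/eqP/(in_A_inj (t := t1) (x := t2)).
have neq12 : t1 != t2 by apply: contraTneq t2A => ->; apply: center_notin_A.
have [-> | _] /= := eqVneq x t1.
  by rewrite (negPf neq12) (negPf t1N) andbF.
by have [-> | _] := eqVneq x t2; rewrite // (negPf t2N).
Qed.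

(** Two common points would make the two cliques equal, putting [t2] in [A t1 i] as well as in
    [A t1 i1]. *)
Lemma card_setI_A_le1 i j : i != i1 -> #|A t1 i :&: A t2 j| <= 1.
Proof.
move=> neq_i; apply/card_le1_eqP => x y.
rewrite !inE => /andP[x1 x2] /andP[y1 y2]; apply/eqP; apply: contraT => neq_yx.
have eqL : t1 |: A t1 i = t2 |: A t2 j.
  by apply: (s_clique_eq (x := x) (y := y)); rewrite ?setU1r // eq_sym.
have := setU11 t2 (A t2 j); rewrite -eqL !inE => /orP[/eqP eq21 | t2i].
  by have := center_notin_A t1 i1; rewrite -{1}eq21 t2A.
by case/eqP: neq_i; apply: in_A_inj t2i t2A.
Qed.

(** A common point would lie in [t1 |: A t1 i1], the clique of the edge, which shares only [t1] with
    [t1 |: A t1 i]. *)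
Lemma setI_A_edge i : i != i1 -> A t1 i :&: A t2 j1 = set0.
Proof.
move=> neq_i; apply/setP => x; rewrite !inE; apply/negP => /andP[xi xj].
have := setU1r t2 xj; rewrite -edge_clique_eq !inE => /orP[/eqP eq_x | xi1].
  by have := center_notin_A t1 i; rewrite -{1}eq_x xi.
by case/eqP: neq_i; apply: in_A_inj xi xi1.
Qed.

Lemma edge_clique_intersections i2 : i2 != i1 ->
  exists j2 : 'I_g,
    unique (fun j : 'I_g => j != j1 /\
      (t1 |: A t1 i2) :&: (t2 |: A t2 j) = set0) j2
    /\ forall j' : 'I_g, j' != j1 -> j' != j2 ->
         exists x : T,
           [/\ (t1 |: A t1 i2) :&: (t2 |: A t2 j') = [set x],
               fa t1 x & fa t2 x].
Proof.
move=> neq_i; pose F j := #|A t1 i2 :&: A t2 j|.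
have F_le1 j : F j <= 1 by apply: card_setI_A_le1.
have sumF : \sum_(j < g | j != j1) F j = g - 2.
  have := A_nbr t2A neq_i; rewrite card_fa_decomp (bigD1 j1) //=.
  by rewrite setI_A_edge // cards0.
(* The deficiencies [1 - F j] are 0 or 1 and add up to [(g - 1) - (g - 2) = 1], so exactly one index
   has [F j = 0]. *)
have /eqP/sum_nat_eq1[j2 [neq_j2 Fj2 F1]] : \sum_(j < g | j != j1) (1 - F j) = 1.
  rewrite sumnB // sumF sum1_card cardC1 card_ord.
  by case: g g_ge2 => [|[|h]] //= _; rewrite !subSS subn0 subSnn.
have single j' : j' != j1 -> j' != j2 ->
    exists x, [/\ (t1 |: A t1 i2) :&: (t2 |: A t2 j') = [set x], fa t1 x & fa t2 x].
  move=> neq_j' neq_j'2; rewrite setI_cliques //.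
  have /cards1P[x defI] : #|A t1 i2 :&: A t2 j'| == 1.
    by rewrite eqn_leq F_le1 -subn_eq0 F1.
  have := set11 x; rewrite -defI inE => /andP[x1 x2].
  by exists x; rewrite defI (in_A_fa x1) (in_A_fa x2).
exists j2; split=> //; split=> [|j [neq_j L0]].
  split=> //; apply/eqP; rewrite setI_cliques // -cards_eq0.
  by move: Fj2; rewrite /F; case: #|_| => // m; rewrite subSS sub0n.
apply/eqP; rewrite eq_sym; apply: contraT => /(single j neq_j)[x [defI _ _]].
by have := set11 x; rewrite -defI L0 inE.
Qed.

End Edge.

End LocalCliqueDecomposition.

Theorem theorem3p6 (T : finType) (fa : rel T) (g s : nat)
    (n : assoc_class -> nat)
    (p : assoc_class -> assoc_class -> assoc_class -> nat)
    (hg : 3 <= g) (hgs : g <= s) (hs : (g - 1) ^ 2 < s)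
    (hL : pseudo_Lg fa g s n p)
    (A : T -> 'I_g -> {set T})
    (A_disj : forall (t : T) (i j : 'I_g), i != j -> [disjoint A t i & A t j])
    (A_card : forall (t : T) (i : 'I_g), #|A t i| = s - 1)
    (A_cover : forall t : T, \bigcup_(i < g) A t i = [set x | fa t x])
    (A_clique : forall (t : T) (i : 'I_g), clique fa (t |: A t i))
    (A_nbr : forall (t : T) (i : 'I_g) (a : T), a \in A t i ->
       forall j : 'I_g, j != i -> #|[set b in A t j | fa a b]| = g - 2) :
  (forall (t : T) (i : 'I_g) (a : T), a \in A t i ->
     unique (clique_through fa s t a) (t |: A t i))
  /\
  (forall (t1 t2 : T), t1 != t2 -> fa t1 t2 ->
   forall i1 j1 : 'I_g, t2 \in A t1 i1 -> t1 \in A t2 j1 ->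
     [/\ t1 |: A t1 i1 = t2 |: A t2 j1
         /\ unique (clique_through fa s t1 t2) (t1 |: A t1 i1),
         forall i2 : 'I_g, i2 != i1 ->
           exists j2 : 'I_g,
             unique (fun j : 'I_g => j != j1 /\
               (t1 |: A t1 i2) :&: (t2 |: A t2 j) = set0) j2
             /\ forall j' : 'I_g, j' != j1 -> j' != j2 ->
                  exists x : T,
                    [/\ (t1 |: A t1 i2) :&: (t2 |: A t2 j') = [set x],
                        fa t1 x & fa t2 x]
       & forall j3 : 'I_g, j3 != j1 ->
           exists i3 : 'I_g,
             unique (fun i : 'I_g => i != i1 /\
               (t2 |: A t2 j3) :&: (t1 |: A t1 i) = set0) i3
             /\ forall i' : 'I_g, i' != i1 -> i' != i3 ->
                  exists x : T,
                    [/\ (t2 |: A t2 j3) :&: (t1 |: A t1 i') = [set x],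
                        fa t1 x & fa t2 x]]).
Proof.
have [fa_sym fa_irr _ _] := pseudo_scheme hL.
have g_ge2 : 2 <= g by apply: ltnW.
split=> [t i a aA | t1 t2 _ _ i1 j1 t2A t1A].
  exact: (unique_clique_through g_ge2 hs).
split=> [|i2 neq_i2 | j3 neq_j3].
- split; first exact: (edge_clique_eq g_ge2 hs).
  exact: (unique_clique_through g_ge2 hs).
- exact: (edge_clique_intersections g_ge2 hs) neq_i2.
(* Part (c) is part (b) with the two ends of the edge exchanged. *)
have [i3 [uniq_i3 single]] :
    _ := edge_clique_intersections g_ge2 hs fa_irr A_disj A_card A_cover A_clique A_nbr
           t1A t2A neq_j3.
exists i3; split=> // i' neq_i' neq_i'3.
by have [x []] := single i' neq_i' neq_i'3; exists x.
Qed.
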